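(* Let $s\in\{1,2,3\}$, and let $\{f^n_{i,j}\}$, $n=0,\dots,N_t$, be produced from initial grid data $\{f^0_{i,j}\}$ by the conservative semi-Lagrangian DIRK scheme of order $s$ with discrete Maxwellian (tolerance $tol$) and conservative correction, with periodic boundary conditions in $x$. Let $m_i^n=(\rho_i^n,\rho_i^nU_i^n,E_i^n)^T$ be the vector of discrete mass, momentum and energy of $f^n$ at $x_i$. Then $$\left\|\sum_{i=1}^{N_x}(m_i^{N_t}-m_i^0)\,\Delta x\right\|_\infty\le\left(\sum_{k=1}^{s-1}|b_k|+|b_s|\right)\frac{N_t\,\Delta t}{\kappa+b_s\Delta t}\,(x_{max}-x_{min})\,tol,$$ where $b_1,\dots,b_s$ are the weights of the DIRK scheme of order $s$ and $\|\cdot\|_\infty$ is the maximum norm on $\mathbb R^3$.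
   Context: The scheme approximates the one-dimensional BGK equation $\partial_t f+v\,\partial_x f=\frac1\kappa(\mathcal M(f)-f)$ with Knudsen number $\kappa>0$, where $\mathcal M(f)$ is the local Maxwellian of $f$. Grid: $\Delta x=(x_{max}-x_{min})/N_x$, $x_i=x_{min}+(i-\frac12)\Delta x$ for $i=1,\dots,N_x$; $\Delta v=(v_{max}-v_{min})/N_v$, $v_j=v_{min}+j\Delta v$ for $j=0,\dots,N_v$; $\Delta t>0$, $t^n=n\Delta t$ for $n=0,\dots,N_t$. The quantity $f^n_{i,j}$ approximates $f(x_i,v_j,t^n)$; all grid quantities are periodic in $i$ with period $N_x$. Let $\phi(v)=(1,v,v^2/2)^T$. The discrete moments are $m_i^n=(\rho_i^n,\rho_i^nU_i^n,E_i^n)^T=\sum_{j=0}^{N_v}f_{i,j}^n\,\phi(v_j)\,\Delta v$. Discrete Maxwellian with tolerance $tol>0$: given grid values $g_{i,j}$, a discrete Maxwellian of $g$ is a grid function $\exp(a_i\cdot\phi(v_j))$, $a_i\in\mathbb R^3$, such that for every $i$, $\left\|\sum_{j=0}^{N_v}\left(\exp(a_i\cdot\phi(v_j))-g_{i,j}\right)\phi(v_j)\Delta v\right\|_\infty\le tol$. It is assumed that such functions are successfully computed at each step below. DIRK coefficients: Butcher tableau with lower triangular $A=(a_{k\ell})_{1\le k,\ell\le s}$, nodes $c_k$ and weights $b_k$, where $a_{s\ell}=b_\ell$ for all $\ell$ (stiffly accurate): - $s=1$ (implicit Euler): $a_{11}=b_1=c_1=1$. - $s=2$: $\alpha=1-\frac{\sqrt2}{2}$,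 $c=(\alpha,1)$, $a_{11}=\alpha$, $a_{21}=b_1=1-\alpha$, $a_{22}=b_2=\alpha$. - $s=3$: $\gamma=0.3$, $\gamma_2=\frac{13}{3}$, $c_2=\frac83$, $c=(\gamma,c_2,1)$, $a_{11}=\gamma$, $a_{21}=c_2-\gamma_2$, $a_{22}=\gamma_2$, $a_{31}=b_1=1-b_2-\gamma$, $a_{32}=b_2=-\frac{3}{710}$, $a_{33}=b_3=\gamma$. One time step $f^n\mapsto f^{n+1}$: Non-conservative step, for $k=1,\dots,s$: 1. $f^{(k,0)}_{ij}$ is the value at $x_i-c_kv_j\Delta t$ obtained by a prescribed (periodic) interpolation in $x$ (such as a generalized WENO interpolation) from $\{f^n_{i,j}\}_i$. 2. $f^{(k)}_{i,j}$ is defined by $f^{(k)}_{i,j}=g^{(k)}_{i,j}+\frac{\Delta t}{\kappa}a_{kk}\left(d\mathcal M^{(k)}_{i,j}-f^{(k)}_{i,j}\right)$, where $g^{(k)}_{i,j}=f^{(k,0)}_{ij}+\Delta t\sum_{\ell=1}^{k-1}a_{k\ell}K^{(k,\ell)}_{ij}$ and $d\mathcal M^{(k)}$ is a discrete Maxwellian of $g^{(k)}$ with tolerance $tol$. 3. $K^{(k)}_{i,j}=\frac1\kappa\left(d\mathcal M^{(k)}_{i,j}-f^{(k)}_{i,j}\right)$. 4. For $\ell=k+1,\dots,s$, $K^{(\ell,k)}_{ij}$ is the value at $x_i-(c_\ell-c_k)v_j\Delta t$ obtained by interpolation in $x$ from $\{K^{(k)}_{i,j}\}_i$. 5. Numerical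 fluxes $\widehat F^{(k)}_{i+\frac12,j}$ (one value at each cell interface, periodic in $i$) are reconstructed from $\{v_jf^{(k)}_{i,j}\}_i$ by a conservative finite-difference WENO reconstruction. Conservative correction step: 1. $f^*_{i,j}=f^n_{i,j}-\frac{\Delta t}{\Delta x}\sum_{\ell=1}^s b_\ell\left(\widehat F^{(\ell)}_{i+\frac12,j}-\widehat F^{(\ell)}_{i-\frac12,j}\right)$. 2. $f^{n+1}_{i,j}$ is defined by $f^{n+1}_{i,j}=f^*_{i,j}+\Delta t\sum_{\ell=1}^{s-1}b_\ell K^{(\ell)}_{i,j}+\frac{\Delta t}{\kappa}b_s\left(d\mathcal M^{( * )}_{i,j}-f^{n+1}_{i,j}\right)$, where $d\mathcal M^{( * )}$ is a discrete Maxwellian of $f^*$ with tolerance $tol$. *)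

(* Defs.v *)
From HB Require Import structures.
From mathcomp Require Import all_boot all_order all_algebra.
From mathcomp Require Import all_classical all_reals all_analysis.

Set Implicit Arguments.
Unset Strict Implicit.
Unset Printing Implicit Defensive.

Import Order.TTheory GRing.Theory Num.Theory.
Import numFieldNormedType.Exports.

Local Open Scope ring_scope.

Record mesh (R : realType) := Mesh {
  Nx : nat;
  Nv : nat;
  xmin : R;
  xmax : R;
  vmin : R;
  vmax : R;
  Nx_gt0 : (0 < Nx)%N;
  Nv_gt0 : (0 < Nv)%N;
  ltr_xmin_xmax : xmin < xmax;
  ltr_vmin_vmax : vmin < vmax }.

Section Grid.
Variables (R : realType) (G : mesh R).

Definition dx : R := (xmax G - xmin G) / (Nx G)%:R.
Definition dv : R := (vmax G - vmin G) / (Nv G)%:R.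

(* Spatial indices are shifted by one: the ordinal i stands for the index i + 1,
   whence x_i = xmin + (i + 1/2) dx.  Periodicity in space is built into the
   index type: the cyclic neighbours of i are [ordS i] and [ord_pred i]. *)
Definition xnode (i : 'I_(Nx G)) : R := xmin G + (i%:R + 2^-1) * dx.
Definition vnode (j : 'I_(Nv G).+1) : R := vmin G + j%:R * dv.

Definition xgridfun := 'I_(Nx G) -> R.
Definition gridfun := 'I_(Nx G) -> 'I_(Nv G).+1 -> R.

Definition phi (v : R) : 'cV[R]_3 := \col_k [:: 1; v; v ^+ 2 / 2]`_k.

(* The vector (rho_i, rho_i U_i, E_i). *)
Definition moments (f : gridfun) (i : 'I_(Nx G)) : 'cV[R]_3 :=
  \sum_(j < (Nv G).+1) (f i j * dv) *: phi (vnode j).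

(* The norm of 'cV[R]_3 is the maximum norm. *)
Definition discrete_maxwellian (tol : R) (g M : gridfun) : Prop :=
  exists2 a : 'I_(Nx G) -> 'cV[R]_3,
    forall i j, M i j = expR (\sum_(k < 3) a i k 0 * phi (vnode j) k 0) &
    forall i, `| \sum_(j < (Nv G).+1)
                   ((M i j - g i j) * dv) *: phi (vnode j) | <= tol.

(* A periodic interpolation procedure, possibly nonlinear in the data. *)
Record interpolation := Interpolation {
  interp :> xgridfun -> R -> R;
  interp_node : forall u i, interp u (xnode i) = u i;
  interp_periodic :
    forall u x, interp u (x + (xmax G - xmin G)) = interp u x }.

End Grid.

Section Weno.
Variable R : realType.

(* The conservative finite-difference approach treats the point values of the
   flux as the cell averages of an auxiliary function, to be evaluated at the
   interfaces.  Given a window w of 2r consecutive values, rescale the cells to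
   [m, m + 1], 0 <= m < 2r, so that the interface to be treated is at r, in the
   middle.  The k-th candidate is p(r), where p is the polynomial of degree < r
   with average w_m over the cell m for k <= m < k + r.  It is obtained as
   the derivative of the polynomial of degree <= r interpolating the primitive,
   i.e. the partial sums of w, at the endpoints of these r cells; the variable of
   the polynomials below is shifted by k. *)
Definition weno_primitive (r k : nat) (w : seq R) : {poly R} :=
  \sum_(m < r.+1)
    (\sum_(l < m) w`_(k + l)) *:
      (tnth (lagrange r.+1 (fun q => q%:R)) m : {poly R}).

Definition weno_candidate (r k : nat) (w : seq R) : R :=
  (deriv (weno_primitive r k w)).[r%:R - k%:R].

(* The nonlinear weights, functions of the transport velocity and of the data in
   the window, form a convex combination.  The candidates 0 <= k < r use
   the left-biased stencils, 0 < k <= r the right-biased ones; upwinding consists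
   in giving weight 0 to the fully downwind stencil according to the sign of
   the velocity.  The choice of smoothness indicators is left free. *)
Record weno := Weno {
  weno_size : nat;
  weno_weight : R -> seq R -> 'I_weno_size.+1 -> R;
  weno_size_gt0 : (0 < weno_size)%N;
  weno_weight_ge0 : forall v w k, 0 <= weno_weight v w k;
  weno_weight_sum1 : forall v w, \sum_k weno_weight v w k = 1 }.

Definition weno_value (W : weno) (v : R) (w : seq R) : R :=
  \sum_(k < (weno_size W).+1)
    weno_weight v w k * weno_candidate (weno_size W) k w.

(* The cells i - r + 1, ..., i + r, centred at the interface i + 1/2. *)
Definition weno_window (N r : nat) (u : 'I_N -> R) (i : 'I_N) : seq R :=
  [seq u (iter m (@ordS N) (iter r.-1 (@ord_pred N) i)) | m <- iota 0 r.*2].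

(* [weno_flux W f i j] is the flux at the interface i + 1/2. *)
Definition weno_flux (G : mesh R) (W : weno) (f : gridfun G) : gridfun G :=
  fun i j => weno_value W (vnode j)
    (weno_window (weno_size W) (fun i' => vnode j * f i' j) i).

End Weno.

(* Stages are numbered from 0: stage k below is stage k + 1 of the usual
   numbering. *)
Section Dirk.
Variable R : realType.

Definition dirk_rows (s : nat) : seq (seq R) :=
  match s with
  | 1 => [:: [:: 1]]
  | 2 => let alpha := 1 - Num.sqrt 2 / 2 in
         [:: [:: alpha];
             [:: 1 - alpha; alpha]]
  | 3 => let gamma := 3 / 10 in
         let gamma2 := 13 / 3 in
         let c2 := 8 / 3 in
         let b2 := - (3 / 710) in
         [:: [:: gamma];
             [:: c2 - gamma2; gamma2];
             [:: 1 - b2 - gamma; b2; gamma]]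
  | _ => [::]
  end.

Definition dirk_nodes (s : nat) : seq R :=
  match s with
  | 1 => [:: 1]
  | 2 => [:: 1 - Num.sqrt 2 / 2; 1]
  | 3 => [:: 3 / 10; 8 / 3; 1]
  | _ => [::]
  end.

Definition dirk_a (s k l : nat) : R := (nth [::] (dirk_rows s) k)`_l.
Definition dirk_c (s k : nat) : R := (dirk_nodes s)`_k.

(* Stiff accuracy: the weights are the last row of the tableau. *)
Definition dirk_b (s l : nat) : R := dirk_a s s.-1 l.

End Dirk.

Section Scheme.
Variables (R : realType) (G : mesh R) (I : interpolation G) (W : weno R).
Variables (s : nat) (kappa dt tol : R).

Local Notation a := (dirk_a R s).
Local Notation b := (dirk_b R s).
Local Notation c := (dirk_c R s).

(* Stage k: [f0], [g], [M], [fs], [K] are f^(k,0), g^(k), dM^(k), f^(k), K^(k)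
   and [KK k l] is K^(k,l). *)
Definition nonconservative_stage (f : gridfun G)
    (f0 g M fs K : nat -> gridfun G) (KK : nat -> nat -> gridfun G) (k : nat) :=
  [/\ forall i j, f0 k i j =
        I (fun i' => f i' j) (xnode i - c k * vnode j * dt),
      forall i j, g k i j =
        f0 k i j + dt * \sum_(l < k) a k l * KK k l i j,
      discrete_maxwellian tol (g k) (M k),
      forall i j, fs k i j =
        g k i j + dt / kappa * a k k * (M k i j - fs k i j) &
      (forall i j, K k i j = kappa^-1 * (M k i j - fs k i j)) /\
      (forall l, (k < l < s)%N -> forall i j, KK l k i j =
        I (fun i' => K k i' j) (xnode i - (c l - c k) * vnode j * dt))].

Definition conservative_correction (f : gridfun G) (fs K : nat -> gridfun G)
    (fstar Mstar f' : gridfun G) :=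
  [/\ forall i j, fstar i j =
        f i j - dt / dx G * \sum_(l < s) b l *
          (weno_flux W (fs l) i j - weno_flux W (fs l) (ord_pred i) j),
      discrete_maxwellian tol fstar Mstar &
      forall i j, f' i j =
        fstar i j + dt * \sum_(l < s.-1) b l * K l i j
        + dt / kappa * b s.-1 * (Mstar i j - f' i j)].

(* Maxwellians are not unique for tol > 0 and the implicit equations are kept as
   equations, so the time step f |-> f' is a relation. *)
Definition csl_dirk_step (f f' : gridfun G) : Prop :=
  exists (f0 g M fs K : nat -> gridfun G) (KK : nat -> nat -> gridfun G)
         (fstar Mstar : gridfun G),
    (forall k, (k < s)%N -> nonconservative_stage f f0 g M fs K KK k) /\
    conservative_correction f fs K fstar Mstar f'.

End Scheme.

(* Main.v *)
Require Import Defs.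
From HB Require Import structures.
From mathcomp Require Import all_boot all_order all_algebra.
From mathcomp Require Import all_classical all_reals all_analysis.
From mathcomp Require Import ring lra.

Set Implicit Arguments.
Unset Strict Implicit.
Unset Printing Implicit Defensive.

Import Order.TTheory GRing.Theory Num.Theory.
Import numFieldNormedType.Exports.

Local Open Scope ring_scope.

(** Mass, momentum and energy are linear functionals of the grid data, and in
one time step only two things change their total over the domain.  Transport
changes it by nothing: the correction [fstar - f] is a difference of fluxes
through neighbouring interfaces, which telescopes around the periodic grid
([transport_conserves]).  Collisions change it by at most the defect of the
discrete Maxwellians: solving an implicit relaxation
[f = g + lambda (M - f)] for its residual gives
[M - f = (M - g) / (1 + lambda)] ([relaxation_residual]), so every collision
term, although written with the unknown [f], is a multiple of the difference
[M - g] whose moments are bounded by the tolerance.  Altogether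
[f' - fstar] is [dt / (kappa + b_s dt)] times the combination of the differences
[M_l - g_l] and [Mstar - fstar] with coefficients
[b_l kappa / (kappa + a_ll dt)] and [b_s] ([correction_increment]).  As the
diagonal of the tableau is positive, these coefficients are at most [|b_l|] and
[|b_s|] in absolute value, which bounds the drift in one cell and one step;
summing over cells and steps gives the factors [xmax - xmin] and [Nt]. *)

(** * Discrete moments *)

Section Moments.
Variables (R : realType) (G : mesh R).
Implicit Types f g : gridfun G.

Lemma momentsB f g i :
  moments (fun i j => f i j - g i j) i = moments f i - moments g i.
Proof.
rewrite /moments -sumrB; apply: eq_bigr => j _.
by rewrite mulrBl scalerBl.
Qed.

Lemma momentsD f g i :
  moments (fun i j => f i j + g i j) i = moments f i + moments g i.
Proof.
rewrite /moments -big_split; apply: eq_bigr => j _.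
by rewrite mulrDl scalerDl.
Qed.

Lemma momentsZ (c : R) f i :
  moments (fun i j => c * f i j) i = c *: moments f i.
Proof.
rewrite /moments scaler_sumr; apply: eq_bigr => j _.
by rewrite scalerA mulrA.
Qed.

Lemma moments_sum n (F : 'I_n -> gridfun G) i :
  moments (fun i j => \sum_(l < n) F l i j) i = \sum_(l < n) moments (F l) i.
Proof.
rewrite /moments exchange_big; apply: eq_bigr => j _.
by rewrite mulr_suml scaler_suml.
Qed.

Lemma sum_moments f :
  \sum_i moments f i =
  \sum_(j < (Nv G).+1) ((\sum_i f i j) * dv G) *: phi (vnode j).
Proof.
rewrite /moments exchange_big; apply: eq_bigr => j _.
by rewrite mulr_suml scaler_suml.
Qed.

Lemma dx_gt0 : 0 < dx G.
Proof. by rewrite divr_gt0 ?ltr0n ?Nx_gt0 ?subr_gt0 ?ltr_xmin_xmax. Qed.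

Lemma dx_Nx : dx G * (Nx G)%:R = xmax G - xmin G.
Proof. by rewrite /dx divfK // pnatr_eq0 -lt0n Nx_gt0. Qed.

Lemma discrete_maxwellian_moments (tol : R) g M i :
  discrete_maxwellian tol g M ->
  `|moments (fun i j => M i j - g i j) i| <= tol.
Proof. by case=> a _ /(_ i). Qed.

End Moments.

Lemma sum_ord_pred (V : zmodType) N (u : 'I_N -> V) :
  \sum_i (u i - u (ord_pred i)) = 0.
Proof.
rewrite sumrB [X in X - _](reindex_inj (@ord_pred_inj N)) /=.
exact: subrr.
Qed.

(** * Implicit relaxation *)

(** Multiplying the step [lambda = dt a / kappa] out leaves the denominator
[kappa + dt a] of the error bound. *)
Lemma relaxation_residual (F : fieldType) (kappa dt a g M f : F) :
  kappa != 0 -> kappa + dt * a != 0 ->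
  f = g + dt / kappa * a * (M - f) ->
  M - f = kappa / (kappa + dt * a) * (M - g).
Proof.
move=> k0 ka0 E; apply: (mulfI ka0).
have -> : (kappa + dt * a) * (kappa / (kappa + dt * a) * (M - g)) =
  kappa * (M - g) by field.
have -> : g = f - dt / kappa * a * (M - f) by rewrite {1}E addrK.
by field.
Qed.

Lemma sqrt2_lt2 (R : realType) : Num.sqrt 2 < 2 :> R.
Proof.
have := sqr_sqrtr (ler0n R 2); have := sqrtr_ge0 (2 : R).
nra.
Qed.

Lemma dirk_diag_gt0 (R : realType) s k :
  s \in [:: 1; 2; 3]%N -> (k < s)%N -> 0 < dirk_a R s k k.
Proof.
have h := sqrt2_lt2 R.
rewrite !inE => /or3P[] /eqP -> ; move: k => [|[|[|k]]] //= _;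
  rewrite /dirk_a /=; lra.
Qed.

(** * One time step *)

Section Step.
Variables (R : realType) (G : mesh R) (I : interpolation G) (W : weno R).
Variables (s : nat) (kappa dt tol : R).
Hypothesis hs : s \in [:: 1; 2; 3]%N.
Hypotheses (kappa_gt0 : 0 < kappa) (dt_gt0 : 0 < dt).

Local Notation a := (dirk_a R s).
Local Notation b := (dirk_b R s).

Lemma last_stage_lt : (s.-1 < s)%N.
Proof. by move: hs; rewrite !inE => /or3P[] /eqP ->. Qed.

Lemma relaxation_denominator_gt0 k : (k < s)%N -> 0 < kappa + dt * a k k.
Proof. by move=> ks; rewrite addr_gt0 ?mulr_gt0 // dirk_diag_gt0. Qed.

Lemma transport_conserves (f fstar : gridfun G) (fs : nat -> gridfun G) :
  (forall i j, fstar i j =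
     f i j - dt / dx G * \sum_(l < s) b l *
       (weno_flux W (fs l) i j - weno_flux W (fs l) (ord_pred i) j)) ->
  \sum_i moments (fun i j => fstar i j - f i j) i = 0.
Proof.
move=> E; rewrite sum_moments big1 // => j _.
suff -> : \sum_i (fstar i j - f i j) = 0 by rewrite mul0r scale0r.
under eq_bigr do rewrite E addrAC subrr add0r.
rewrite sumrN -mulr_sumr exchange_big /= big1 ?mulr0 ?oppr0 // => l _.
by rewrite -mulr_sumr (sum_ord_pred (fun i => weno_flux W (fs l) i j)) mulr0.
Qed.

(** The final update is itself a relaxation, towards [Mstar], of
[fstar + dt * \sum b_l K_l]; substituting the residuals of the stages for the
[K_l] leaves only differences that the tolerance controls. *)
Lemma correction_increment f f0 g M fs K KK (fstar Mstar f' : gridfun G) i j :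
  (forall k, (k < s)%N ->
     nonconservative_stage I s kappa dt tol f f0 g M fs K KK k) ->
  conservative_correction W s kappa dt tol f fs K fstar Mstar f' ->
  f' i j - fstar i j = dt / (kappa + b s.-1 * dt) *
    (\sum_(l < s.-1)
       b l * (kappa / (kappa + dt * a l l)) * (M l i j - g l i j)
     + b s.-1 * (Mstar i j - fstar i j)).
Proof.
move=> stage [_ _ /(_ i j) E].
have k0 : kappa != 0 by rewrite gt_eqF.
have d0 := relaxation_denominator_gt0 last_stage_lt.
have EK : \sum_(l < s.-1) b l * K l i j = kappa^-1 * \sum_(l < s.-1)
    b l * (kappa / (kappa + dt * a l l)) * (M l i j - g l i j).
  rewrite mulr_sumr; apply: eq_bigr => l _.
  have ls : (l < s)%N := ltn_trans (ltn_ord l) last_stage_lt.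
  have [_ _ _ Ef [-> _]] := stage l ls.
  rewrite (relaxation_residual k0 _ (Ef i j)); first by ring.
  by rewrite gt_eqF ?relaxation_denominator_gt0.
rewrite EK in E; set S := (\sum_(l < s.-1) _) in E *.
(* Stiff accuracy: [b s.-1] is the last diagonal entry of the tableau. *)
have b0 : kappa + dt * b s.-1 != 0 by rewrite gt_eqF.
have R' := relaxation_residual k0 b0 E.
rewrite [b s.-1 * dt]mulrC.
have -> : f' i j = Mstar i j - (Mstar i j - f' i j) by ring.
by rewrite R'; field; rewrite k0 b0.
Qed.

(** The damping factors [kappa / (kappa + dt a_ll)] of the stages are at most 1
because [a_ll > 0], so dropping them leaves the weights [|b_l|] alone. *)
Lemma step_drift (f f' : gridfun G) : 0 <= tol ->
  csl_dirk_step I W s kappa dt tol f f' ->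
  `|\sum_i (moments f' i - moments f i)| <=
  (Nx G)%:R * (dt / (kappa + b s.-1 * dt) *
    ((\sum_(l < s.-1) `|b l| + `|b s.-1|) * tol)).
Proof.
move=> tol0 [f0 [g [M [fs [K [KK [fstar [Mstar [stage corr]]]]]]]]].
have [Estar Hstar _] := corr.
have -> : \sum_i (moments f' i - moments f i) =
    \sum_i moments (fun i j => f' i j - fstar i j) i.
  apply: subr0_eq; rewrite -sumrB -[RHS](transport_conserves Estar).
  by apply: eq_bigr => i _; rewrite !momentsB opprB addrC subrKA.
have d0 : 0 < dt / (kappa + b s.-1 * dt).
  by rewrite divr_gt0 // mulrC relaxation_denominator_gt0 ?last_stage_lt.
rewrite [leRHS]mulr_natl -[in leRHS](card_ord (Nx G)) -sumr_const.
apply: le_trans (ler_norm_sum _ _ _) _; apply: ler_sum => i _.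
(* Writing the increment as a linear combination lets linearity of the moments
   reduce the claim to the tolerances. *)
under [X in moments X]eq_fun => i' do
  under eq_fun => j do rewrite (correction_increment i' j stage corr).
rewrite momentsZ momentsD momentsZ moments_sum.
rewrite normrZ gtr0_norm // ler_wpM2l ?(ltW d0) // mulrDl.
apply: le_trans (ler_normD _ _) _; apply: lerD; last first.
  by rewrite normrZ ler_wpM2l //; apply: discrete_maxwellian_moments.
rewrite mulr_suml; apply: le_trans (ler_norm_sum _ _ _) _.
apply: ler_sum => l _.
have ls : (l < s)%N := ltn_trans (ltn_ord l) last_stage_lt.
have [_ _ HM _ _] := stage l ls.
have a0 := dirk_diag_gt0 R hs ls.
have ka0 := relaxation_denominator_gt0 ls.
rewrite momentsZ normrZ ler_pM //; last exact: discrete_maxwellian_moments.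
rewrite normrM ler_piMr // ger0_norm ?divr_ge0 ?ltW //.
by rewrite ltr_pdivrMr // mul1r ltrDl mulr_gt0.
Qed.

End Step.

(** * Accumulation over the time steps *)

Theorem propositionD1 (R : realType) (s : nat) (hs : s \in [:: 1; 2; 3]%N)
    (G : mesh R) (I : interpolation G) (W : weno R) (kappa dt tol : R)
    (kappa_gt0 : 0 < kappa) (dt_gt0 : 0 < dt) (tol_gt0 : 0 < tol)
    (Nt : nat) (f : nat -> gridfun G)
    (hf : forall n, (n < Nt)%N ->
            csl_dirk_step I W s kappa dt tol (f n) (f n.+1)) :
  `| \sum_(i < Nx G) dx G *: (moments (f Nt) i - moments (f 0%N) i) | <=
    (\sum_(k < s.-1) `|dirk_b R s k| + `|dirk_b R s s.-1|)
    * (Nt%:R * dt / (kappa + dirk_b R s s.-1 * dt))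
    * (xmax G - xmin G) * tol.
Proof.
rewrite -scaler_sumr normrZ gtr0_norm ?dx_gt0 //.
have -> : \sum_i (moments (f Nt) i - moments (f 0%N) i) =
    \sum_(n < Nt) \sum_i (moments (f n.+1) i - moments (f n) i).
  rewrite exchange_big /=; apply: eq_bigr => i _.
  by rewrite -(big_mkord xpredT (fun n => moments (f n.+1) i - moments (f n) i))
    telescope_sumr.
set b := dirk_b R s.
pose B := (Nx G)%:R * (dt / (kappa + b s.-1 * dt) *
  ((\sum_(l < s.-1) `|b l| + `|b s.-1|) * tol)).
have drift : `|\sum_(n < Nt) \sum_i (moments (f n.+1) i - moments (f n) i)|
    <= Nt%:R * B.
  rewrite mulr_natl -[in leRHS](card_ord Nt) -sumr_const.
  apply: le_trans (ler_norm_sum _ _ _) _.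
  apply: ler_sum => n _.
  exact: (step_drift hs kappa_gt0 dt_gt0 (ltW tol_gt0) (hf n (ltn_ord n))).
apply: le_trans (ler_wpM2l (ltW (dx_gt0 G)) drift) _.
have -> // : dx G * (Nt%:R * B) = (\sum_(k < s.-1) `|b k| + `|b s.-1|)
    * (Nt%:R * dt / (kappa + b s.-1 * dt)) * (xmax G - xmin G) * tol.
rewrite -dx_Nx /B; move: (\sum_(k < _) _ + _) (dx G) (_^-1) => x y z.
by ring.
Qed.
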